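(* Let $(A,f)$ be a monounary algebra. Then the following are equivalent: (1) $A$ is residually finite; (2) for all distinct $x,y\in A$ such that $f(x)=f(y)$, there exists $n\in\mathbb{N}$ such that either $f^{-n}(x)=\varnothing$ or $f^{-n}(y)=\varnothing$.
   Context: $\mathbb{N}$ is the set of non-negative integers. A monounary algebra $(A,f)$ is a (possibly empty) set $A$ with a function $f:A\to A$. A homomorphism $\phi:(A,f_1)\to(B,f_2)$ is a function $\phi:A\to B$ with $\phi(f_1(a))=f_2(\phi(a))$ for all $a\in A$. A monounary algebra $A$ is residually finite if for all distinct $x,y\in A$ there exist a finite monounary algebra $F$ and a homomorphism $\phi:A\to F$ such that $\phi(x)\neq\phi(y)$. For $a\in A$ and $n\in\mathbb{N}$, $f^{-n}(a)=\{b\in A: f^n(b)=a\}$, where $f^n$ is the $n$-fold iterate of $f$ and $f^0$ is the identity. *)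

(* Defs.v *)
From mathcomp Require Import all_boot classical_sets.

Set Implicit Arguments.
Unset Strict Implicit.
Unset Printing Implicit Defensive.

Local Open Scope classical_set_scope.

(* A monounary algebra is given by a carrier [A : Type], possibly empty,
   together with an arbitrary function [f : A -> A]. *)

Definition monounary_hom (A B : Type) (f1 : A -> A) (f2 : B -> B)
    (phi : A -> B) : Prop :=
  forall a : A, phi (f1 a) = f2 (phi a).

Definition residually_finite (A : Type) (f : A -> A) : Prop :=
  forall x y : A, x <> y ->
    exists (F : finType) (g : F -> F) (phi : A -> F),
      monounary_hom f g phi /\ phi x <> phi y.

Definition iter_preimage (A : Type) (f : A -> A) (n : nat) (a : A) : set A :=
  [set b | iter n f b = a].

(* Main.v *)
Require Import Defs.
From mathcomp Require Import all_boot boolp classical_sets.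

(** Residual finiteness amounts to separating points by properties [P] of
    elements for which the sequence of pullbacks [P], [P \o f], [P \o f^2], ...
    takes finitely many values: recording the truth values of these pullbacks
    at a point is a homomorphism to a finite algebra
    ([separated_by_recognizable]).

    If no iterate of [f] identifies [x] and [y], some modulus [c > 0] is such
    that [f^i x = f^j y] never holds with [i] and [j] congruent modulo [c]
    ([separating_modulus]), and the property of meeting the orbit of [x] with a
    delay divisible by [c], which has period [c] under pullback, separates [x]
    from [y].  If some iterate identifies them, their orbits contain distinct
    [x'] and [y'] at the same time, with [f x' = f y'].  It suffices to separate
    these; one of them, say [x'], has no [n]-th preimage for some [n], and then
    equality to [x'] is a property whose pullbacks vanish from rank [n] on.

    Conversely, let [phi] be a homomorphism to a finite algebra.  If [x] and [y]
    have iterated preimages of all orders, then [phi x] and [phi y] are periodic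
    ([deep_image_periodic]); two periodic points with the same image are equal,
    so [f x = f y] forces [phi x = phi y]. *)

Local Open Scope classical_set_scope.

(** * Homomorphisms and iterates *)

Lemma hom_iter (A B : Type) (f : A -> A) (g : B -> B) (phi : A -> B) n a :
  monounary_hom f g phi -> phi (iter n f a) = iter n g (phi a).
Proof. by move=> hom; elim: n => //= n <-; exact: hom. Qed.

Lemma iter_mul_period (A : Type) (g : A -> A) p k u :
  iter p g u = u -> iter (k * p) g u = u.
Proof. by move=> gu; elim: k => // k IH; rewrite mulSn iterD IH. Qed.

Lemma empty_iter_preimageP (A : Type) (f : A -> A) n x :
  iter_preimage f n x = set0 <-> forall a, iter n f a <> x.
Proof. by rewrite -subset0; split=> h a /= /h. Qed.

(** * Residual finiteness bounds one of two colliding preimage trees *)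

(** Among the first [#|F| + 1] points of the orbit of [u] two coincide, so that
    the orbit has entered its cycle by time [#|F|]. *)
Lemma deep_image_periodic (F : finType) (g : F -> F) (u : F) :
  exists2 p, 0 < p & iter p g (iter #|F| g u) = iter #|F| g u.
Proof.
pose orb (i : 'I_#|F|.+1) := iter i g u.
have /injectivePn [i [j ij gij]] : ~~ injectiveb orb.
  apply/injectiveP => /leq_card; by rewrite card_ord ltnn.
wlog lt_ij : i j ij gij / i < j.
  move=> wl; have := ij; rewrite -val_eqE neq_ltn.
  by case/orP => ?; [exact: (wl i j) | apply: (wl j i) => //; rewrite eq_sym].
exists (j - i); first by rewrite subn_gt0.
have cyc n : iter (j - i) g (iter (n + i) g u) = iter (n + i) g u.
  by rewrite -iterD addnCA subnK ?(ltnW lt_ij) // !iterD [iter j g u](esym gij).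
have iF : i <= #|F| by rewrite -ltnS.
by have := cyc (#|F| - i); rewrite subnK.
Qed.

(** The map [g] is injective on its periodic points: [u] and [v] have a common
    period [p * q], hence are the same iterate of [g u = g v]. *)
Lemma periodic_collision (A : Type) (g : A -> A) p q u v :
    0 < p -> 0 < q -> iter p g u = u -> iter q g v = v -> g u = g v -> u = v.
Proof.
move=> p0 q0 gu gv guv.
rewrite -(iter_mul_period A g p q u gu) -(iter_mul_period A g q p v gv).
rewrite (mulnC p).
have: 0 < q * p by rewrite muln_gt0 q0.
by case: (q * p) => // n _; rewrite !iterSr guv.
Qed.

(** * Separation by recognizable properties *)

(** The point [a] is sent to the vector of truth values of [P (f^i a)], [i < m].
    Applying [f] shifts this vector; the entry that enters at the end is a copy
    of entry [k], which makes the shift a function of the vector alone. *)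
Lemma separated_by_recognizable (A : Type) (f : A -> A) (P : A -> Prop) m k :
    k < m -> (forall a, P (iter m f a) <-> P (iter k f a)) ->
  forall x y, P x -> ~ P y ->
  exists (F : finType) (g : F -> F) (phi : A -> F),
    monounary_hom f g phi /\ phi x <> phi y.
Proof.
move=> km Pmk x y Px Py.
pose next (i : 'I_m) : 'I_m := insubd (Ordinal km) i.+1.
exists {ffun 'I_m -> bool}.
exists (fun s : {ffun 'I_m -> bool} => [ffun i => s (next i)]).
exists (fun a => [ffun i : 'I_m => `[< P (iter i f a) >]]); split=> [a|].
  apply/ffunP => i; rewrite !ffunE -iterSr val_insubd.
  case: ltnP => // mi; apply: asbool_equiv_eq.
  by have -> : i.+1 = m by apply/eqP; rewrite eqn_leq mi ltn_ord.
have m0 : 0 < m := leq_ltn_trans (leq0n k) km.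
by move/ffunP/(_ (Ordinal m0)); rewrite !ffunE /= asboolT // asboolF.
Qed.

(** The separating property is equality to [x]: its pullbacks of ranks [n] and
    [n + 1] are both identically false. *)
Lemma separated_by_empty_preimage (A : Type) (f : A -> A) n x y :
    x <> y -> (forall a, iter n f a <> x) ->
  exists (F : finType) (g : F -> F) (phi : A -> F),
    monounary_hom f g phi /\ phi x <> phi y.
Proof.
move=> xy nx; apply: (separated_by_recognizable A f (eq^~ x) n.+1 n) => //.
- by move=> a; rewrite iterSr; split=> /nx.
- by move=> /esym.
Qed.

(** If the orbit of [x] is eventually periodic, any period [c] works: when
    [i] and [j] are congruent modulo [c], shifting [f^i x = f^j y] into the
    periodic part gives a common value at equal times.  If the orbit of [x] is
    injective, the difference [i - j] is the same for all meetings; it is not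
    zero, so a modulus exceeding its absolute value works. *)
Lemma separating_modulus (A : Type) (f : A -> A) x y :
    (forall n, iter n f x <> iter n f y) ->
  exists2 c, 0 < c &
    forall i j, iter i f x = iter j f y -> i <> j %[mod c].
Proof.
move=> nxy.
have [[c c0 [t ft]]|aper] :=
  pselect (exists2 c, 0 < c & exists t, iter (t + c) f x = iter t f x).
  exists c => // i j fij ij.
  have per s k : iter (k * c + (s + t)) f x = iter (s + t) f x.
    rewrite iterD; apply: iter_mul_period.
    by rewrite -iterD addnCA iterD addnC ft -iterD.
  apply: (nxy (j + t)); rewrite [in RHS]addnC [in RHS]iterD -fij -iterD.
  (* Both times are at least [t] and congruent modulo [c]. *)
  have [le_ij|/ltnW le_ji] := leqP i j.
    have /dvdnP [k ek] : c %| j - i by rewrite -eqn_mod_dvd // ij.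
    by rewrite -(subnK le_ij) ek -addnA per addnC.
  have /dvdnP [k ek] : c %| i - j by rewrite -eqn_mod_dvd // ij.
  by rewrite [t + i]addnC -(subnK le_ji) ek -addnA per.
have inj i j : iter i f x = iter j f x -> i = j.
  wlog le_ij : i j / i <= j.
    move=> wl fij; have [|/ltnW] := leqP i j; first by move/wl; exact.
    by move/wl => h; apply/esym/h.
  move: le_ij; rewrite leq_eqVlt => /orP [/eqP //|lt_ij] fij.
  case: aper; exists (j - i); first by rewrite subn_gt0.
  by exists i; rewrite subnKC // ltnW.
have [[i0 [j0 f0]]|nolink] :=
  pselect (exists i j, iter i f x = iter j f y); last first.
  by exists 1 => // i j fij; case: nolink; exists i, j.
exists (i0 + j0).+1 => // i j fij ij.
have e : j0 + i = j + i0.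
  by apply: inj; rewrite iterD fij -iterD addnC iterD -f0 -iterD.
have /eqP : j + j0 = j + i0 %[mod (i0 + j0).+1].
  by rewrite -e [j0 + i]addnC -modnDml -ij modnDml.
rewrite eqn_modDl !modn_small ?ltnS ?leq_addr ?leq_addl // => /eqP e0.
by apply: (nxy i0); rewrite f0 e0.
Qed.

(** The separating property of [a] is that the orbits of [x] and [a] meet after
    numbers of steps congruent modulo [c].  Replacing [a] by [f^c a] changes the
    number of steps from [a] by [c], hence preserves the property. *)
Lemma separated_by_delay (A : Type) (f : A -> A) x y :
    (forall n, iter n f x <> iter n f y) ->
  exists (F : finType) (g : F -> F) (phi : A -> F),
    monounary_hom f g phi /\ phi x <> phi y.
Proof.
move=> nxy; have [c c0 sep] := separating_modulus A f x y nxy.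
pose P a := exists i j, iter i f x = iter j f a /\ i = j %[mod c].
apply: (separated_by_recognizable A f P c 0 c0).
- move=> a; split=> -[i [j [e ij]]].
    by exists i, (j + c); rewrite modnDr iterD.
  exists (i + c), j; rewrite modnDr; split=> //.
  by rewrite [i + c]addnC iterD e /= -!iterD addnC.
- by exists 0, 0.
- by move=> [i [j [e ij]]]; exact: sep e ij.
Qed.

(** * The characterization *)

Theorem theorem4p3 (A : Type) (f : A -> A) :
  residually_finite f <->
  (forall x y : A, x <> y -> f x = f y ->
     exists n : nat, iter_preimage f n x = set0 \/ iter_preimage f n y = set0).
Proof.
split=> [rf x y xy fxy|H x y xy].
  have [F [g [phi [hom phixy]]]] := rf x y xy.
  have [[p p0 gp]|nx] := pselect (exists2 p, 0 < p & iter p g (phi x) = phi x);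
    last first.
    exists #|F|; left; apply/empty_iter_preimageP => a ax; apply: nx.
    by rewrite -ax (hom_iter A F f g phi) //; exact: deep_image_periodic.
  exists #|F|; right; apply/empty_iter_preimageP => a ay; apply: phixy.
  have [q q0] := deep_image_periodic F g (phi a).
  rewrite -(hom_iter A F f g phi) // ay => gq.
  by apply: (periodic_collision F g p q) => //; rewrite -!hom fxy.
have [ex|nex] := pselect (exists n, iter n f x = iter n f y); last first.
  by apply: separated_by_delay => n e; apply: nex; exists n.
(* The orbits stay together once they agree; [n] is the last time at which
   they differ. *)
have [n xy' fxy'] : exists2 n, iter n f x <> iter n f y &
                               f (iter n f x) = f (iter n f y).
  case: ex; elim=> [//|n IH e].
  by have [/IH|] := pselect (iter n f x = iter n f y); last by exists n.
suff [F [g [phi [hom sep]]]] : exists (F : finType) (g : F -> F) (phi : A -> F),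
    monounary_hom f g phi /\ phi (iter n f x) <> phi (iter n f y).
  exists F, g, phi; split=> // e; apply: sep.
  by rewrite !(hom_iter A F f g phi) // e.
have [m [/empty_iter_preimageP ex'|/empty_iter_preimageP ey']] := H _ _ xy' fxy'.
  exact: (separated_by_empty_preimage A f m).
have [F [g [phi [hom sep]]]] :=
  separated_by_empty_preimage A f m _ _ (nesym xy') ey'.
by exists F, g, phi; split=> // /esym.
Qed.
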